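(* Let $M$ be a geodesic pointed metric space, $N$ a pointed metric space and $\phi:N\to M$ a Lipschitz map of Lipschitz norm one with $\phi(0)=0$. Assume that the composition operator $C_\phi:\mathrm{Lip}_0(M)\to\mathrm{Lip}_0(N)$, $C_\phi(f)=f\circ\phi$, is isometric. Then, for every $x\neq y$ in $M$, every isometry $\alpha:[0,d(x,y)]\to M$ connecting $x$ and $y$, and every inverse projection $P:M\to[0,d(x,y)]$ of $\alpha$, the following holds: for every $t\in[0,d(x,y)]$ there exist sequences $\{x_n\},\{y_n\}$ in $N$ such that $x_n\neq y_n$ for every $n\in\mathbb N$, $P(\phi(x_n))\to t$, $P(\phi(y_n))\to t$ and $$\frac{P(\phi(x_n))-P(\phi(y_n))}{d(x_n,y_n)}\longrightarrow 1.$$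
   Context: A pointed metric space is a metric space with a distinguished point, denoted $0$. For a pointed metric space $M$, $\mathrm{Lip}_0(M)$ is the real Banach space of all Lipschitz functions $f:M\to\mathbb R$ with $f(0)=0$, with norm $\|f\|=\sup\{\frac{f(x)-f(y)}{d(x,y)}: x\neq y\in M\}$. The Lipschitz norm of a Lipschitz map between metric spaces is its best Lipschitz constant. ''$C_\phi$ is isometric'' means $\|C_\phi(f)\|=\|f\|$ for all $f\in\mathrm{Lip}_0(M)$ (no surjectivity is required). A metric space $M$ is geodesic if for every pair of distinct points $x,y\in M$ the distance $d(x,y)$ equals the minimum (attained) of the lengths of the rectifiable curves joining $x$ and $y$. An isometry $\alpha:[0,d(x,y)]\to M$ connecting $x$ and $y$ is a distance-preserving (not necessarily onto) map with $\alpha(0)=x$ and $\alpha(d(x,y))=y$. An inverse projection of $\alpha$ is a Lipschitz function $P:M\to[0,d(x,y)]$ with Lipschitz norm $\|P\|=1$ such that $P\circ\alpha$ is the identity mapping on $[0,d(x,y)]$. *)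

(* Defs.v *)
From HB Require Import structures.
From mathcomp Require Import all_boot all_order all_algebra.
From mathcomp Require Import all_classical all_reals all_analysis.

Set Implicit Arguments.
Unset Strict Implicit.
Unset Printing Implicit Defensive.

Import Order.TTheory GRing.Theory Num.Theory.
Import numFieldNormedType.Exports.

Local Open Scope classical_set_scope.
Local Open Scope ring_scope.

(* The distinguished point [0] of a pointed metric space is [point]. *)
#[short(type="pointedMetricType")]
HB.structure Definition PointedMetric (K : numDomainType) :=
  { M of Metric K M & isPointed M }.

Section lipschitz_maps.
Context {R : realType} {A B : metricType R}.
Implicit Type f : A -> B.

Definition lip_bounds f : set R :=
  [set L | 0 <= L /\ forall a b, mdist (f a) (f b) <= L * mdist a b].

Definition is_lipschitz f : Prop := lip_bounds f !=set0.

(* Best Lipschitz constant; meaningful only when [is_lipschitz f], since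
   [inf set0 = 0]. *)
Definition lip_const f : R := inf (lip_bounds f).

End lipschitz_maps.

Section Lip0.
Context {R : realType}.

(* [R^o] is the alias of [R] on which the library puts the metric
   [`|s - t|]. *)
Definition Lip0 (M : pointedMetricType R) : set (M -> R) :=
  [set f | is_lipschitz (f : M -> R^o) /\ f point = 0].

Definition Lip0_norm (M : pointedMetricType R) (f : M -> R) : R :=
  sup [set r | exists x y : M, x != y /\ r = (f x - f y) / mdist x y].

Definition comp_op (N M : pointedMetricType R) (phi : N -> M)
    (f : M -> R) : N -> R := f \o phi.

Lemma comp_op_Lip0 (N M : pointedMetricType R) (phi : N -> M) :
  is_lipschitz phi -> phi point = point ->
  forall f, Lip0 f -> Lip0 (comp_op phi f).
Proof.
move=> [L [L0 HL]] phi0 f [[K [K0 HK]] f0]; split; last by rewrite /comp_op/= phi0.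
exists (K * L); split; first exact: mulr_ge0.
move=> a b; apply: (le_trans (HK _ _)).
by rewrite -mulrA; apply: ler_wpM2l.
Qed.

Definition comp_op_isometric (N M : pointedMetricType R) (phi : N -> M) : Prop :=
  forall f, Lip0 f -> Lip0_norm (comp_op phi f) = Lip0_norm f.

End Lip0.

Section geodesic.
Context {R : realType} {M : metricType R}.
Implicit Types (a b : R) (gamma : R -> M).

(* [itv_partition a b s] says that [a :: s] is strictly increasing and ends at
   [b], so this is the analogue of [variation] for metric-valued maps. *)
Definition polygonal_length a b gamma (s : seq R) : R :=
  \sum_(0 <= i < size s)
    mdist (gamma (nth b (a :: s) i)) (gamma (nth b (a :: s) i.+1)).

Definition curve_length a b gamma : \bar R :=
  ereal_sup [set (polygonal_length a b gamma s)%:E | s in itv_partition a b].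

(* A curve is a continuous map on [[a, b]]; values of [gamma] outside are
   irrelevant. *)
Definition rectifiable_curve a b gamma : Prop :=
  [/\ a <= b, {within `[a, b], continuous gamma} &
      (curve_length a b gamma < +oo)%E].

Definition lengths_joining (x y : M) : set (\bar R) :=
  [set l | exists a b gamma, [/\ rectifiable_curve a b gamma,
     gamma a = x, gamma b = y & l = curve_length a b gamma]].

End geodesic.

Definition is_geodesic (R : realType) (M : metricType R) : Prop :=
  forall x y : M, x != y ->
    lengths_joining x y (mdist x y)%:E /\
    lbound (lengths_joining x y) (mdist x y)%:E.

Section inverse_projections.
Context {R : realType} {M : metricType R}.

Definition isometry_connecting (x y : M) (alpha : R -> M) : Prop :=
  [/\ {in `[0, mdist x y] &, forall s t, mdist (alpha s) (alpha t) = `|s - t|},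
      alpha 0 = x & alpha (mdist x y) = y].

(* A map into [[0, d(x, y)]] is an [R]-valued map with all values in that
   interval; this does not change its Lipschitz norm. *)
Definition inverse_projection (x y : M) (alpha : R -> M) (P : M -> R) : Prop :=
  [/\ forall z, P z \in `[0, mdist x y],
      is_lipschitz (P : M -> R^o), lip_const (P : M -> R^o) = 1 &
      {in `[0, mdist x y], forall s, P (alpha s) = s}].

End inverse_projections.

(* Main.v *)
(** Compose [P] with [u |-> u - k u |u|], centred at [t], where
    [k = 1 / (2 d(x, y))]. On [[-d(x, y), d(x, y)]] this map is increasing and
    1-Lipschitz, and its slopes are close to 1 only near [0]. The resulting
    function on [M] has slopes tending to 1 along [alpha] near [alpha t], so by
    isometry of the composition operator its composite with [phi] has slopes
    close to 1 on [N]. Since [P] and [phi] are 1-Lipschitz, this forces both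
    [P (phi x_n)] and [P (phi y_n)] to approach [t] and the slopes of
    [P \o phi] to approach 1. *)

Require Import Defs.
From HB Require Import structures.
From mathcomp Require Import all_boot all_order all_algebra.
From mathcomp Require Import all_classical all_reals all_analysis.
From mathcomp Require Import ring lra.

Import Order.TTheory GRing.Theory Num.Theory.
Import numFieldNormedType.Exports.

Local Open Scope classical_set_scope.
Local Open Scope ring_scope.

Set Implicit Arguments.
Unset Strict Implicit.
Unset Printing Implicit Defensive.

(** For distinct points, the quotient of the two distances lies below every Lipschitz bound, hence
    below their infimum. *)
Lemma mdist_le_lip_const (R : realType) (A B : metricType R) (f : A -> B) :
  is_lipschitz f ->
  forall a b, mdist (f a) (f b) <= lip_const f * mdist a b.
Proof.
move=> f_lip a b; have [->|ab] := eqVneq a b; first by rewrite !mdistxx mulr0.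
have d0 : 0 < mdist a b by rewrite mdist_gt0.
rewrite -ler_pdivrMr//; apply: lb_le_inf => // L [_ /(_ a b)].
by rewrite ler_pdivrMr.
Qed.

Lemma Lip0_norm_ge_slope (R : realType) (M : pointedMetricType R) (f : M -> R) :
  Lip0 f -> forall a b, a != b -> (f a - f b) / mdist a b <= Lip0_norm f.
Proof.
move=> [[L [_ HL]] _] a b ab; apply: ub_le_sup; last by exists a, b.
exists L => _ [c [d [cd ->]]]; rewrite ler_pdivrMr ?mdist_gt0//.
(* The distance of [R^o] unfolds to a norm with the two values swapped, hence [distrC]
   afterwards. *)
have cd_le : `|f d - f c| <= L * mdist c d := HL c d.
by apply: le_trans cd_le; rewrite distrC ler_norm.
Qed.

(** The condition [0 <= r] rules out a one-point [M], where the set of slopes is empty and its [sup]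
    is the default [0]. *)
Lemma Lip0_norm_slope_gt (R : realType) (M : pointedMetricType R) (f : M -> R)
    (r : R) :
  0 <= r < Lip0_norm f -> exists a b, a != b /\ r < (f a - f b) / mdist a b.
Proof.
case/andP=> r0; rewrite /Lip0_norm; set S := (X in sup X) => rS.
have [S0|/set0P/negP/negPn/eqP S0] := pselect (S !=set0).
  by have [_ [a [b [ab ->]]] rs] := sup_gt S0 rS; exists a, b.
by move: rS; rewrite S0 sup0 ltNge r0.
Qed.

Section warp.
Context {R : realType}.
Implicit Types k D u v : R.

Definition warp k u := u - k * (u * `|u|).

(** If [u] and [v] have the same sign, [u|u| - v|v|] equals [(u - v)(|u| + |v|)]. For opposite signs
    it is [u^2 + v^2], which is at least half of that product because [(u + v)^2 >= 0]. *)
Lemma warp_sub_le k u v : 0 <= k -> v <= u ->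
  warp k u - warp k v <= (u - v) * (1 - k * ((`|u| + `|v|) / 2)).
Proof.
move=> k0 vu; rewrite /warp.
suff : (u - v) * ((`|u| + `|v|) / 2) <= u * `|u| - v * `|v|.
  by move/(ler_wpM2l k0); lra.
have uv0 : 0 <= u - v by rewrite subr_ge0.
have := mulr_ge0 uv0 (addr_ge0 (normr_ge0 u) (normr_ge0 v)).
have := sqr_ge0 (u + v).
by have [u0|u0] := ger0P u; have [v0|v0] := ger0P v; nra.
Qed.

(** The derivative [1 - 2k|u|] is nonnegative on [[-D, D]]. *)
Lemma warp_nondecreasing k D u v : 0 <= k -> 2 * k * D <= 1 ->
  `|u| <= D -> `|v| <= D -> v <= u -> warp k v <= warp k u.
Proof.
move=> k0 kD uD vD vu; rewrite -subr_ge0 /warp.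
suff : u * `|u| - v * `|v| <= (u - v) * (2 * D).
  by move/(ler_wpM2l k0); nra.
by move: uD vD; have [u0|u0] := ger0P u; have [v0|v0] := ger0P v; nra.
Qed.

Lemma warp_contract k D u v : 0 <= k -> 2 * k * D <= 1 ->
  `|u| <= D -> `|v| <= D -> `|warp k u - warp k v| <= `|u - v|.
Proof.
move=> k0 kD; wlog vu : u v / v <= u => [H uD vD|uD vD].
  have [vu|/ltW uv] := leP v u; first exact: H.
  by rewrite distrC (distrC u); exact: H.
have Hle := warp_nondecreasing k0 kD uD vD vu.
rewrite !ger0_norm ?subr_ge0//; apply: (le_trans (warp_sub_le k0 vu)).
have := mulr_ge0 k0 (addr_ge0 (normr_ge0 u) (normr_ge0 v)); nra.
Qed.

Lemma warp_steep k D d e u v : 0 <= k -> 2 * k * D <= 1 ->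
    `|u| <= D -> `|v| <= D -> 0 < d -> e <= 1 -> `|u - v| <= d ->
    (1 - e) * d < warp k u - warp k v ->
  k * (`|u| + `|v|) <= 2 * e /\ (1 - e) * d <= u - v.
Proof.
move=> k0 kD uD vD d0 e1 uvd H.
have vu : v < u.
  rewrite ltNge; apply/negP => uv.
  have := warp_nondecreasing k0 kD vD uD uv; nra.
have := warp_sub_le k0 (ltW vu).
have := mulr_ge0 k0 (addr_ge0 (normr_ge0 u) (normr_ge0 v)).
move: uvd; rewrite gtr0_norm ?subr_gt0//; move: H.
have : 0 < u - v by rewrite subr_gt0.
set a := warp k u - warp k v; set w := k * (`|u| + `|v|); set c := u - v.
move=> c0 H cd w0 ac.
have {}ac : a <= c * (1 - w / 2) by apply: le_trans ac _; rewrite /w mulrA.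
have wc : 0 <= w * c by rewrite mulr_ge0// ltW.
split; last by lra.
(* If [w > 2e], then [a <= c(1 - w/2) < (1 - e)c <= (1 - e)d < a], which is absurd. *)
rewrite leNgt; apply/negP => ew.
have : 0 < (w - 2 * e) * c by rewrite mulr_gt0// subr_gt0.
have : (1 - e) * c <= (1 - e) * d by rewrite ler_wpM2l// subr_ge0.
lra.
Qed.

End warp.

(** Since [P] inverts [alpha], slopes along [alpha] are those of [warp k] on the line. Between [0]
    and a point at distance [h] this slope is [1 - k h], so it suffices that [k h <= e]. *)
Lemma exists_warp_slope_gt (R : realType) (M : metricType R) (x y : M)
    (alpha : R -> M) (P : M -> R) (k t e : R) :
  x != y -> isometry_connecting x y alpha -> inverse_projection x y alpha P ->
  0 <= k -> k * mdist x y <= 1 -> t \in `[0, mdist x y] -> 0 < e <= 1 ->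
  exists a b, a != b /\
    1 - e <= (warp k (P a - t) - warp k (P b - t)) / mdist a b.
Proof.
move=> xy [iso _ _] [_ _ _ PK] k0 kD tI /andP[e0 e1].
have D0 : 0 < mdist x y by rewrite mdist_gt0.
have [t0 tD] : 0 <= t /\ t <= mdist x y by move: tI; rewrite in_itv/= => /andP.
have [s [u [sI uI su [dk warpE]]]] : exists s u, [/\ s \in `[0, mdist x y],
    u \in `[0, mdist x y], u < s & k * (s - u) <= e /\
    warp k (s - t) - warp k (u - t) = (s - u) * (1 - k * (s - u))].
  have [t_lt|Dt] := ltP t (mdist x y).
    (* The factor [e] yields [k h <= e], and [e <= 1] keeps [t + h] in the interval. *)
    pose h := e * (mdist x y - t).
    have h0 : 0 < h by rewrite mulr_gt0// subr_gt0.
    have hD : h <= mdist x y - t by rewrite ler_piMl// subr_ge0 ltW.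
    have kh : k * h <= e.
      rewrite mulrCA (ler_piMr (ltW e0))//; apply: le_trans kD.
      by rewrite ler_wpM2l// lerBlDr lerDl.
    have sE : t + h - t = h by ring.
    exists (t + h), t; rewrite sE; split => //.
    - by rewrite in_itv/=; apply/andP; split; lra.
    - by rewrite ltrDl.
    - by split=> //; rewrite /warp subrr normr0 ger0_norm ?ltW//; ring.
  (* At the right endpoint the second point is taken to the left of [t]. *)
  have tE : t = mdist x y by apply/eqP; rewrite eq_le tD Dt.
  pose h := e * t.
  have h0 : 0 < h by rewrite mulr_gt0// tE.
  have ht : h <= t by rewrite ler_piMl.
  have kh : k * h <= e.
    by rewrite mulrCA (ler_piMr (ltW e0))// tE.
  have uE : t - h - t = - h by ring.
  have sE : t - (t - h) = h by ring.
  exists t, (t - h); rewrite uE sE; split => //.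
  - by rewrite in_itv/=; apply/andP; split; lra.
  - by rewrite ltrBlDr ltrDl.
  - by split=> //; rewrite /warp subrr normr0 normrN ger0_norm ?ltW//; ring.
have d_su : mdist (alpha s) (alpha u) = s - u.
  by rewrite iso// gtr0_norm// subr_gt0.
exists (alpha s), (alpha u); split; first by rewrite -mdist_gt0 d_su subr_gt0.
by rewrite d_su !PK// warpE mulrC mulKf ?lerB// subr_eq0 gt_eqF.
Qed.

Unset Implicit Arguments.

Theorem theorem3p7 (R : realType) (M N : pointedMetricType R) (phi : N -> M)
  (M_geodesic : is_geodesic M)
  (phi_lip : is_lipschitz phi) (phi_norm : lip_const phi = 1)
  (phi0 : phi point = point)
  (Cphi_isometric : comp_op_isometric phi) :
  forall (x y : M) (alpha : R -> M) (P : M -> R),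
    x != y ->
    isometry_connecting x y alpha ->
    inverse_projection x y alpha P ->
    forall t : R, t \in `[0, mdist x y] ->
      exists xn yn : nat -> N,
        [/\ forall n, xn n != yn n,
            P (phi (xn n)) @[n --> \oo] --> t,
            P (phi (yn n)) @[n --> \oo] --> t &
            (P (phi (xn n)) - P (phi (yn n))) / mdist (xn n) (yn n)
              @[n --> \oo] --> (1 : R)].
Proof.
move=> x y alpha P xy alpha_iso P_proj t tI.
have [P_itv P_lip P_norm _] := P_proj.
have D0 : 0 < mdist x y by rewrite mdist_gt0.
pose k := (2 * mdist x y)^-1.
have k_gt0 : 0 < k by rewrite invr_gt0 mulr_gt0.
have k0 := ltW k_gt0.
have kD : 2 * k * mdist x y = 1.
  by rewrite mulrAC mulfV// mulf_neq0// ?pnatr_eq0// gt_eqF.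
have phi_contr a b : mdist (phi a) (phi b) <= mdist a b.
  by have := mdist_le_lip_const phi_lip a b; rewrite phi_norm mul1r.
have P_contr a b : `|P a - P b| <= mdist a b.
  by have := mdist_le_lip_const P_lip a b; rewrite P_norm mul1r distrC.
have Pt_le z : `|P z - t| <= mdist x y.
  move: (P_itv z) tI; rewrite !in_itv/= ler_norml => /andP[? ?] /andP[? ?].
  by apply/andP; split; lra.
(* Subtracting the value at [point] puts [f] in [Lip0] without changing any slope. *)
pose f z := warp k (P z - t) - warp k (P point - t).
have fB a b : f a - f b = warp k (P a - t) - warp k (P b - t) by rewrite /f; ring.
have f_Lip0 : Lip0 f.
  split; last by rewrite /f subrr.
  exists 1; split=> // a b; rewrite mul1r; apply: le_trans (P_contr a b).
  rewrite [leLHS](_ : _ = `|f b - f a|)// distrC fB.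
  rewrite [leRHS](_ : _ = `|(P a - t) - (P b - t)|); last by congr `|_|; ring.
  by apply: (warp_contract k0 _ (Pt_le a) (Pt_le b)); rewrite kD.
have f_norm : 1 <= Lip0_norm f.
  apply/ler_addgt0Pr => e e0; pose e' := Num.min e 1.
  have e'I : 0 < e' <= 1 by rewrite lt_min e0 ltr01 ge_min lexx orbT.
  have kD1 : k * mdist x y <= 1 by nra.
  have [a [b [ab]]] := exists_warp_slope_gt xy alpha_iso P_proj k0 kD1 tI e'I.
  rewrite -fB => /le_trans/(_ (Lip0_norm_ge_slope f_Lip0 ab)).
  have : e' <= e by rewrite ge_min lexx.
  lra.
have steep n : exists p : N * N, p.1 != p.2 /\
    1 - harmonic n < (f (phi p.1) - f (phi p.2)) / mdist p.1 p.2.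
  (* As [harmonic n] is [1 / (n + 1)], the threshold starts at [0] and always stays below [1]. *)
  have [|a [b ab]] := @Lip0_norm_slope_gt _ _ (comp_op phi f) (1 - harmonic n).
    rewrite Cphi_isometric// subr_ge0 invf_le1 ?ler1n ?ltr0n//=.
    by apply: lt_le_trans f_norm; rewrite ltrBlDr ltrDl invr_gt0 ltr0n.
  by exists (a, b).
have [p pP] := choice steep.
(* This is [warp_steep] with [d] the distance of the pair in [N] and [e] the value [harmonic n]: one
   half locates the points near [t], the other bounds the slope from below. *)
have pE n : k * (`|P (phi (p n).1) - t| + `|P (phi (p n).2) - t|)
      <= 2 * harmonic n /\
    (1 - harmonic n) * mdist (p n).1 (p n).2
      <= P (phi (p n).1) - P (phi (p n).2).
  have [ne] := pP n; rewrite ltr_pdivlMr ?mdist_gt0// fB => H.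
  have e1 : harmonic n <= 1 :> R by rewrite invf_le1 ?ler1n ?ltr0n.
  have shift : (P (phi (p n).1) - t) - (P (phi (p n).2) - t) =
    P (phi (p n).1) - P (phi (p n).2) by ring.
  rewrite -shift; apply: (warp_steep k0 _ (Pt_le _) (Pt_le _) _ e1 _ H).
  - by rewrite kD.
  - by rewrite mdist_gt0.
  - by rewrite shift; exact: le_trans (P_contr _ _) (phi_contr _ _).
have cvg_t (z : nat -> N) :
    (forall n, k * `|P (phi (z n)) - t| <= 2 * harmonic n) ->
    P (phi (z n)) @[n --> \oo] --> t.
  move=> zP; apply/cvgrPdist_le => e e0.
  have ke0 : 0 < k * e / 2 by rewrite divr_gt0// mulr_gt0.
  have /cvgr0Pnorm_le/(_ _ ke0) := @cvg_harmonic R.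
  apply: filterS => n; rewrite ger0_norm ?invr_ge0 ?ler0n// => hn.
  rewrite distrC -(ler_pM2l k_gt0).
  by have := zP n; lra.
exists (fun n => (p n).1), (fun n => (p n).2); split.
- by move=> n; have [] := pP n.
- by apply: cvg_t => n; have [+ _] := pE n; rewrite mulrDr; apply: le_trans;
    rewrite lerDl mulr_ge0.
- by apply: cvg_t => n; have [+ _] := pE n; rewrite mulrDr; apply: le_trans;
    rewrite lerDr mulr_ge0.
(* The upper bound [1] holds because [P] and [phi] do not increase distances. *)
- apply: (@squeeze_cvgr _ _ _ _ (fun n => 1 - harmonic n) (fun=> 1)).
  + near=> n; have [ne _] := pP n; have [_ Hn] := pE n.
    rewrite ler_pdivlMr ?mdist_gt0// Hn ler_pdivrMr ?mdist_gt0// mul1r.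
    exact: le_trans (ler_norm _) (le_trans (P_contr _ _) (phi_contr _ _)).
  + by rewrite -[X in _ --> X]subr0; apply: cvgB; [exact: cvg_cst|exact: cvg_harmonic].
  + exact: cvg_cst.
Unshelve. all: by end_near.
Qed.
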